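(* Let $S$ be a $p\times p$ random sample covariance matrix (based on $n$ observations) whose diagonal entries satisfy, marginally, $$\hat\sigma_\nu^2:=S_{\nu\nu}\sim\sigma_\nu^2\,\chi^2_{(n)}/n,\qquad \nu=1,\dots,p,$$ for some population variances $\sigma_\nu^2>0$, with no assumption on the joint distribution of $\{\hat\sigma_\nu^2\}$. Let $1\le k\le p$, let $\sigma_{(1)}^2\ge\sigma_{(2)}^2\ge\cdots$ and $\hat\sigma_{(1)}^2\ge\hat\sigma_{(2)}^2\ge\cdots$ denote the ordered population and sample variances, let $\gamma>0$, and put $\alpha_n=\gamma n^{-1/2}(\log n)^{1/2}$. Define $$I_{in}=\{l:\sigma_l^2\ge\sigma_{(k)}^2(1+\alpha_n)\},\qquad I_{out}=\{l:\sigma_l^2\le\sigma_{(k)}^2(1-\alpha_n)\},$$ and the events of false exclusion and false inclusion $$FE=\bigcup_{l\in I_{in}}\{\hat\sigma_l^2<\hat\sigma_{(k)}^2\},\qquad FI=\bigcup_{l\in I_{out}}\{\hat\sigma_l^2\ge\hat\sigma_{(k)}^2\}.$$ Then $$P\{FE\cup FI\}\le 2pk\,n^{-b(\gamma)}+k\,n^{-(1-2\alpha_n)b(\gamma)},\qquad b(\gamma)=\Bigl[\frac{\gamma\sqrt3}{4+2\sqrt3}\Bigr]^2.$$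
   Context: $\chi^2_{(n)}$ denotes a chi-square random variable with $n$ degrees of freedom. The selected subset $\hat I_k$ consists of the indices of the $k$ largest sample variances $\hat\sigma_\nu^2$; $FE$ means some index in $I_{in}$ is not selected and $FI$ means some index in $I_{out}$ is selected. *)

(* Defs.v *)
From HB Require Import structures.
From mathcomp Require Import all_boot all_order all_algebra.
From mathcomp Require Import all_classical all_reals all_analysis.
Set Implicit Arguments. Unset Strict Implicit. Unset Printing Implicit Defensive.
Import Order.TTheory GRing.Theory Num.Theory.
Local Open Scope classical_set_scope.
Local Open Scope ring_scope.

Definition chisq_kernel {R : realType} (n : nat) (t : R) : R :=
  if 0 < t then t `^ (n%:R / 2 - 1) * expR (- t / 2) else 0.

(* Normalising constant 2^(n/2) Gamma(n/2), written as the integral itself. *)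
Definition chisq_const {R : realType} (n : nat) : \bar R :=
  (\int[@lebesgue_measure R]_(t in [set t : R | (0 < t)%R]) (chisq_kernel n t)%:E)%E.

Definition chisq_pdf {R : realType} (n : nat) (t : R) : R :=
  chisq_kernel n t / fine (@chisq_const R n).

Definition chisq_cdf {R : realType} (n : nat) (x : R) : \bar R :=
  (\int[@lebesgue_measure R]_(t in [set t : R | (t <= x)%R]) (chisq_pdf n t)%:E)%E.

Definition kth_largest {R : realType} (p : nat) (f : 'I_p -> R) (k : nat) : R :=
  nth 0 (sort (fun x y : R => y <= x) [seq f i | i <- enum 'I_p]) k.-1.

Definition bexp {R : realType} (gamma : R) : R :=
  (gamma * Num.sqrt 3 / (4 + 2 * Num.sqrt 3)) ^+ 2.

Definition alpha_n {R : realType} (gamma : R) (n : nat) : R :=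
  gamma * (n%:R) `^ (- (1/2)) * Num.sqrt (ln n%:R).

(* Main.v *)
Require Import Defs.
From HB Require Import structures.
From mathcomp Require Import all_boot all_order all_algebra.
From mathcomp Require Import all_classical all_reals all_analysis.
From mathcomp Require Import measurable_realfun ring lra.
Import Order.TTheory GRing.Theory Num.Theory.
Import numFieldNormedType.Exports.
Set Implicit Arguments. Unset Strict Implicit. Unset Printing Implicit Defensive.
Local Open Scope classical_set_scope.
Local Open Scope ring_scope.

(** Write [e1 = 4 a / (4 + 2 sqrt 3)] and [e2 = a - e1].  A false exclusion needs
    some [l] in [I_in] and some [j] with [sigma2 j <= sk] such that
    [shat2 l < shat2 j], hence a large deviation of one of the two across the
    threshold [sk (1 + e1)]; a false inclusion likewise needs a deviation of some
    [l] in [I_out] or of some [j] with [sk <= sigma2 j] across [sk (1 - e2)].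
    The union bound over single indices (rather than pairs) and the chi-square
    tail bounds [exp (- n e^2 / 4)] (lower) and [exp (- 3 n e^2 / 16)] (upper)
    conclude, since [e1] and [e2] equalise the two exponents to
    [b(gamma) log n].  The tails come from the substitution [t = c u], which
    gives [c f(c u) = c^(n/2) e^((1-c)u/2) f(u)] for the chi-square density [f];
    that [f] has total mass 1 follows from its being the law of [shat2]. *)

Lemma kth_largest_up (R : realType) (p : nat) (f : 'I_p -> R) (k : nat)
    (q : pred R) :
  (forall x y, x <= y -> q x -> q y) -> (0 < k <= p)%N ->
  q (kth_largest f k) = (k <= #|[set j | q (f j)]%SET|)%N.
Proof.
move=> qup /andP[k0 kp]; rewrite /kth_largest.
set s := sort _ _.
have sE : perm_eq s [seq f i | i <- enum 'I_p] by rewrite perm_sort.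
have ss : size s = p by rewrite (perm_size sE) size_map size_enum_ord.
have -> : #|[set j | q (f j)]%SET| = count q s.
  rewrite (seq.permP sE) count_map cardsE cardE /enum_mem size_filter count_filter.
  by apply: eq_count => i /=; rewrite !inE andbT.
have srt i j : (i <= j < p)%N -> nth 0 s j <= nth 0 s i.
  move=> /andP[ij jp].
  apply: (sorted_leq_nth (leT := fun x y : R => y <= x)) => //.
  - by move=> x y z /= yx zx; exact: le_trans zx yx.
  - by apply: sort_sorted => x y; exact: le_total.
  - by rewrite inE ss (leq_ltn_trans ij).
  - by rewrite inE ss.
have k1p : (k.-1 < p)%N by rewrite prednK.
apply/idP/idP => [qk|].
  rewrite -(cat_take_drop k s) count_cat.
  have /eqP -> : count q (take k s) == k.
    rewrite -{2}(@size_takel k _ s) ?ss// -all_count.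
    apply/(all_nthP 0) => i; rewrite size_takel ?ss// => ik.
    rewrite nth_take//; apply: qup qk; apply: srt.
    by rewrite k1p andbT -ltnS prednK.
  exact: leq_addr.
apply: contraTT => nqk; rewrite -ltnNge.
rewrite -(cat_take_drop k.-1 s) count_cat.
have /eqP -> : count q (drop k.-1 s) == 0%N.
  rewrite -leqn0 leqNgt -has_count; apply/(has_nthP 0) => -[i].
  rewrite size_drop ss nth_drop => ik /qup qi.
  move/negP : nqk; apply; apply: qi; apply: srt.
  by rewrite leq_addr -ltn_subRL.
rewrite addn0 (leq_ltn_trans (count_size _ _))// size_takel ?prednK//.
by rewrite ss ltnW.
Qed.

Lemma ge0_integral_scale (R : realType) (c : R) (D : set R) (f : R -> \bar R) :
  0 < c -> measurable D -> measurable_fun [set: R] f -> (forall x, 0 <= f x)%E ->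
  (\int[@lebesgue_measure R]_(x in D) f x =
   c%:E * \int[@lebesgue_measure R]_(x in [set x | D (c * x)%R]) f (c * x)%R)%E.
Proof.
move=> c0 mD mf f0.
have mc : measurable_fun setT (fun x : measurableTypeR R => c * x : measurableTypeR R).
  exact: measurable_funM.
pose phi (x : measurableTypeR R) : measurableTypeR R := c * x.
pose nu' : {measure set (measurableTypeR R) -> \bar R} :=
  mscale (NngNum (ltW c0)) (pushforward (@lebesgue_measure R) phi).
pose nu := nu' mc.
have nuE A : measurable A -> nu A = lebesgue_measure A.
  move=> mA; apply/esym/lebesgue_measure_unique => //= _ [[a b]] _ <-.
  rewrite /mscale/= /pushforward/=.
  rewrite [phi @^-1` _](_ : _ = [set` `](a / c), (b / c)]])/=; last first.
    by apply/seteqP; split => x;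
      rewrite /phi/= !in_itv/= ltr_pdivrMr// ler_pdivlMr// (mulrC x).
  rewrite !lebesgue_measure_itv/= !lte_fin ltr_pM2r ?invr_gt0//.
  case: ifPn => _; last by rewrite mule0.
  by rewrite -!EFinB -EFinM -mulrBl mulrCA divff ?mulr1// gt_eqF.
transitivity (\int[nu]_(x in D) f x)%E.
  by apply: eq_measure_integral => A mA _; exact/esym/nuE.
rewrite ge0_integral_mscale//=; last exact: measurable_funTS.
by rewrite ge0_integral_pushforward//; exact: measurable_funTS.
Qed.


Lemma is_derive_quad_ln (R : realType) (b z : R) : 0 < z ->
  is_derive z 1 (fun z : R => z - 1 - b * (z - 1) ^+ 2 - ln z)
    (1 - 2 * b * (z - 1) - z^-1).
Proof.
move=> z0.
have h : is_derive z 1 (@ln R) z^-1 by exact: is_derive1_ln.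
rewrite (_ : (fun z : R => _) =
  ((id - cst 1) - b *: (id - cst 1) ^+ 2 - @ln R : R -> R)); last first.
  by apply/funext => x; rewrite !fctE.
apply: is_derive_eq.
by rewrite subr0 !fctE /= expr1 /GRing.scale/=; ring.
Qed.

Lemma within_continuous_quad_ln (R : realType) (b x y : R) : 0 < x ->
  {within `[x, y], continuous (fun z : R => z - 1 - b * (z - 1) ^+ 2 - ln z)}.
Proof.
move=> x0; apply: derivable_within_continuous => z; rewrite in_itv/= => /andP[xz _].
by case: (is_derive_quad_ln b (lt_le_trans x0 xz)).
Qed.

Lemma ln1D_le (R : realType) (x : R) : 0 <= x <= 1 / 3 ->
  ln (1 + x) <= x - 3 / 8 * x ^+ 2.
Proof.
move=> /andP[x0 x3].
pose f (z : R) := z - 1 - 3 / 8 * (z - 1) ^+ 2 - ln z.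
suff : f 1 <= f (1 + x) by rewrite /f ln1 (_ : 1 + x - 1 = x); lra.
apply: (@ger0_derive1_ndecr _ f 1 (1 + x) _ _ _ 1 (1 + x)); last 3 first.
- by rewrite lexx.
- by rewrite lerDl.
- by rewrite lexx.
- move=> z; rewrite in_itv/= => /andP[z1 _].
  have z0 : 0 < z by lra.
  by case: (is_derive_quad_ln (3 / 8) z0).
- move=> z; rewrite in_itv/= => /andP[z1 zx].
  have z0 : 0 < z by lra.
  rewrite derive1E (@derive_val _ _ _ _ _ _ _ (is_derive_quad_ln (3 / 8) z0)).
  rewrite (_ : _ - z^-1 = (z - 1) * (4 - 3 * z) / 4 / z); last by field; rewrite gt_eqF.
  by rewrite !divr_ge0 ?mulr_ge0//; lra.
- by apply: within_continuous_quad_ln; rewrite ltr01.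
Qed.

Lemma ln1B_le (R : realType) (x : R) : 0 <= x < 1 ->
  ln (1 - x) <= - x - x ^+ 2 / 2.
Proof.
move=> /andP[x0 x1].
pose f (z : R) := z - 1 - 1 / 2 * (z - 1) ^+ 2 - ln z.
suff : f 1 <= f (1 - x) by rewrite /f ln1 (_ : 1 - x - 1 = - x); lra.
apply: (@ler0_derive1_nincr _ f (1 - x) 1 _ _ _ (1 - x) 1); last 3 first.
- by rewrite lexx.
- by rewrite gerBl.
- by rewrite lexx.
- move=> z; rewrite in_itv/= => /andP[z1 _].
  have z0 : 0 < z by lra.
  by case: (is_derive_quad_ln (1 / 2) z0).
- move=> z; rewrite in_itv/= => /andP[z1 zx].
  have z0 : 0 < z by lra.
  rewrite derive1E (@derive_val _ _ _ _ _ _ _ (is_derive_quad_ln (1 / 2) z0)).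
  rewrite (_ : _ - z^-1 = - ((z - 1) ^+ 2 / z)); last by field; rewrite gt_eqF.
  by rewrite oppr_le0 divr_ge0 ?sqr_ge0 ?ltW.
- by apply: within_continuous_quad_ln; rewrite subr_gt0.
Qed.

Lemma measurable_sublevel (R : realType) (d : measure_display)
    (T : measurableType d) (X : T -> R) (M : R) :
  measurable_fun setT X -> measurable [set w | X w <= M].
Proof.
move=> mX; rewrite -[X in measurable X]setTI (_ : [set w | _] = X @^-1` `]-oo, M]).
  exact: mX.
by apply/seteqP; split => w /=; rewrite in_itv.
Qed.

Lemma measurable_superlevel (R : realType) (d : measure_display)
    (T : measurableType d) (X : T -> R) (M : R) :
  measurable_fun setT X -> measurable [set w | M < X w].
Proof.
move=> mX; rewrite (_ : [set w | _] = ~` [set w | X w <= M]).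
  exact/measurableC/measurable_sublevel.
by apply/seteqP; split => w /=; rewrite ltNge => /negP.
Qed.

Section chisq.
Context {R : realType}.
Local Notation mu := (@lebesgue_measure R).

Lemma measurable_chisq_pdf (n : nat) : measurable_fun setT (@chisq_pdf R n).
Proof.
rewrite /chisq_pdf; apply: measurable_funM => //.
apply: measurable_fun_ifT => //.
  exact: measurable_fun_ltr.
apply: measurable_funM; first exact: measurable_powR.
by apply: measurableT_comp => //; apply: measurable_funM => //; exact: measurable_oppr.
Qed.

Lemma chisq_pdf_ge0 (n : nat) (t : R) : 0 <= chisq_pdf n t.
Proof.
have k0 (u : R) : 0 <= chisq_kernel n u.
  by rewrite /chisq_kernel; case: ifP => // _; rewrite mulr_ge0 ?powR_ge0 ?expR_ge0.
by rewrite /chisq_pdf divr_ge0// fine_ge0// integral_ge0// => u _; rewrite lee_fin.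
Qed.

(* Rescaling multiplies the density by an exponential tilt: this replaces the
   moment generating function in the Chernoff bound. *)
Lemma chisq_pdf_scale (n : nat) (c u : R) : 0 < c ->
  c * chisq_pdf n (c * u) =
  c `^ (n%:R / 2) * expR ((1 - c) * u / 2) * chisq_pdf n u.
Proof.
move=> c0; rewrite /chisq_pdf /chisq_kernel pmulr_rgt0//.
case: ifPn => [u0|_]; last by rewrite !mul0r !mulr0.
rewrite powRM ?(ltW c0) ?(ltW u0)//.
have -> : c `^ (n%:R / 2) = c * c `^ (n%:R / 2 - 1).
  rewrite -{2}(@powRr1 _ c) ?(ltW c0)// -powRD ?(gt_eqF c0) ?implybT//.
  by congr (_ `^ _); lra.
have -> : - (c * u) / 2 = (1 - c) * u / 2 + - u / 2 by lra.
rewrite expRD; ring.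
Qed.

Lemma chisq_tail (n : nat) (c : R) (D : set R) : 0 < c -> measurable D ->
  (forall u, D u -> (1 - c) * u <= (1 - c) * n%:R) ->
  (\int[mu]_(t in [set t | D (t / c)%R]) (chisq_pdf n t)%:E <=
   (expR (n%:R / 2 * (ln c + 1 - c)))%:E * \int[mu]_t (chisq_pdf n t)%:E)%E.
Proof.
move=> c0 mD Dn.
have mpdf : measurable_fun setT (EFin \o @chisq_pdf R n).
  by apply/measurable_EFinP; exact: measurable_chisq_pdf.
rewrite (ge0_integral_scale c0)//; last 2 first.
- have mdiv : measurable_fun [set: R] (fun t : R => t / c) by exact: measurable_funM.
  by rewrite -[X in measurable X]setTI; exact: mdiv.
- by move=> x; rewrite lee_fin chisq_pdf_ge0.
rewrite (_ : [set x | _] = D); last first.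
  apply/seteqP; split => x /=; rewrite [c * x]mulrC mulfK ?gt_eqF//.
have mcpdf : measurable_fun setT (fun t : R => (chisq_pdf n (c * t))%:E).
  apply/measurable_EFinP; apply: measurableT_comp; first exact: measurable_chisq_pdf.
  exact: measurable_funM.
rewrite -ge0_integralZl//; last 3 first.
- exact: measurable_funTS.
- by move=> x _; rewrite lee_fin chisq_pdf_ge0.
- by rewrite lee_fin ltW.
apply: (@le_trans _ _ (\int[mu]_(t in D)
    ((expR (n%:R / 2 * (ln c + 1 - c)))%:E * (chisq_pdf n t)%:E))%E).
  apply: ge0_le_integral => //.
  - by move=> x _; rewrite mule_ge0 ?lee_fin ?chisq_pdf_ge0// ltW.
  - by apply: measurable_funeM; exact: measurable_funTS.
  - by apply: measurable_funeM; exact: measurable_funTS.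
  - move=> x Dx; rewrite -!EFinM lee_fin chisq_pdf_scale//.
    apply: ler_wpM2r; first exact: chisq_pdf_ge0.
    rewrite /powR gt_eqF// -expRD ler_expR.
    have := Dn _ Dx; nra.
rewrite ge0_integralZl//; last 2 first.
- exact: measurable_funTS.
- by move=> x _; rewrite lee_fin chisq_pdf_ge0.
apply: lee_wpmul2l; first by rewrite lee_fin expR_ge0.
apply: ge0_subset_integral => //.
by move=> x _; rewrite lee_fin chisq_pdf_ge0.
Qed.

Lemma chisq_lower_tail (n : nat) (c : R) : 0 < c <= 1 ->
  (\int[mu]_t (chisq_pdf n t)%:E = 1)%E ->
  (chisq_cdf n (c * n%:R) <= (expR (n%:R / 2 * (ln c + 1 - c)))%:E)%E.
Proof.
move=> /andP[c0 c1] tot.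
have := @chisq_tail n c [set u | u <= n%:R] c0 _ _.
rewrite tot mule1 /chisq_cdf.
rewrite (_ : [set t | [set u | u <= n%:R] (t / c)] = [set t | t <= c * n%:R]);
  last first.
  by apply/seteqP; split => t /=; rewrite ler_pdivrMr// mulrC.
apply.
- by rewrite -set_itvNyc; exact: measurable_itv.
- by move=> u /= un; apply: ler_wpM2l => //; rewrite subr_ge0.
Qed.

Lemma chisq_upper_tail (n : nat) (c : R) : 1 <= c ->
  (\int[mu]_t (chisq_pdf n t)%:E = 1)%E ->
  (1 - chisq_cdf n (c * n%:R) <= (expR (n%:R / 2 * (ln c + 1 - c)))%:E)%E.
Proof.
move=> c1 tot; have c0 : 0 < c by rewrite (lt_le_trans _ c1).
have := @chisq_tail n c [set u | n%:R < u] c0 _ _.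
rewrite tot mule1 /chisq_cdf.
rewrite (_ : [set t | [set u | n%:R < u] (t / c)] = [set t | c * n%:R < t]);
  last first.
  by apply/seteqP; split => t /=; rewrite ltr_pdivlMr// mulrC.
move=> h; apply: le_trans (h _ _); last 2 first.
- by rewrite -set_itvoy; exact: measurable_itv.
- by move=> u /= un; apply: ler_wnM2l; [rewrite subr_le0|exact: ltW].
have mL : measurable [set t : R | t <= c * n%:R].
  by rewrite -set_itvNyc; exact: measurable_itv.
have mR : measurable [set t : R | c * n%:R < t].
  by rewrite -set_itvoy; exact: measurable_itv.
have p0 (D : set R) : forall x, D x -> (0 <= (chisq_pdf n x)%:E)%E.
  by move=> x _; rewrite lee_fin chisq_pdf_ge0.
have mpdf (D : set R) : measurable_fun D (fun t => (chisq_pdf n t)%:E).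
  by apply/measurable_EFinP; apply: measurable_funTS; exact: measurable_chisq_pdf.
rewrite -tot leeBlDl//; last first.
  rewrite ge0_fin_numE; last by apply: integral_ge0 => x; exact: p0.
  rewrite (@le_lt_trans _ _ 1%E) ?ltry// -tot.
  by apply: ge0_subset_integral => //; [exact: mpdf|exact: p0].
rewrite -ge0_integral_setU//; last 3 first.
- exact: mpdf.
- exact: p0.
-
  by apply/disj_setPS => t /= [/le_lt_trans h1 /h1]; rewrite ltxx.
rewrite (_ : _ `|` _ = setT)//.
by apply/seteqP; split => // t _ /=; case: (leP t (c * n%:R)) => _; [left|right].
Qed.

Lemma chisq_total (d : measure_display) (T : measurableType d)
    (P : probability T R) (X : T -> R) (n : nat) (s : R) :
  0 < s -> measurable_fun setT X ->
  (forall x, P [set w | X w <= x] = chisq_cdf n (n%:R * x / s)) ->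
  (0 < n)%N -> (\int[mu]_t (chisq_pdf n t)%:E = 1)%E.
Proof.
move=> s0 mX PX n0.
have n0' : 0 < n%:R :> R by rewrite ltr0n.
pose F (i : nat) := [set w | X w <= i%:R].
pose G (i : nat) := [set t : R | t <= n%:R * i%:R / s].
have mF i : measurable (F i) by exact: measurable_sublevel.
have FT : \bigcup_i F i = setT.
  apply/seteqP; split => // w _; exists (Num.truncn (X w)).+1 => //=.
  exact/ltW/truncnS_gt.
have GT : \bigcup_i G i = setT.
  apply/seteqP; split => // t _; exists (Num.truncn (t * s / n%:R)).+1 => //=.
  by rewrite /G/= ler_pdivlMr// [n%:R * _]mulrC -ler_pdivrMr//; exact/ltW/truncnS_gt.
have PF : (P \o F) i @[i --> \oo] --> (1 : \bar R)%E.
  rewrite -(probability_setT P) -FT; apply: nondecreasing_cvg_mu => //.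
    by rewrite FT.
  move=> i j ij; apply/subsetPset => w /= /le_trans; apply; by rewrite ler_nat.
have mG i : measurable (G i) by rewrite /G -set_itvNyc; exact: measurable_itv.
have : (\int[mu]_(t in G i) (chisq_pdf n t)%:E)%E @[i --> \oo] -->
    (\int[mu]_(t in \bigcup_i G i) (chisq_pdf n t)%:E)%E.
  apply: ge0_nondecreasing_set_cvg_integral => //.
  - move=> i j ij; apply/subsetPset => w /= /le_trans; apply.
    by rewrite ler_pM2r ?invr_gt0// ler_pM2l// ler_nat.
  - move=> i; apply/measurable_EFinP; apply: measurable_funTS.
    exact: measurable_chisq_pdf.
  - by move=> i x _; rewrite lee_fin chisq_pdf_ge0.
rewrite GT => PG.
apply: cvg_unique PG _ => //.
rewrite (_ : (fun i => _) = P \o F)//.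
by apply/funext => i /=; rewrite PX.
Qed.


End chisq.

Section deviations.
Context (R : realType) (d : measure_display) (T : measurableType d).
Context (P : probability T R) (X : T -> R) (n : nat) (s : R).
Context (n0 : (0 < n)%N) (s0 : 0 < s) (mX : measurable_fun setT X).
Context (PX : forall x, P [set w | X w <= x] = chisq_cdf n (n%:R * x / s)).

Lemma chisq_lower_dev (e M : R) : 0 <= e < 1 -> M <= s * (1 - e) ->
  (P [set w | (X w <= M)%R] <= (expR (- (n%:R * e ^+ 2 / 4)))%:E)%E.
Proof.
move=> /andP[e0 e1] Ms; pose c := 1 - e.
apply: (@le_trans _ _ (P [set w | X w <= s * c])).
  apply: le_measure; rewrite ?inE; [exact: measurable_sublevel..|].
  by move=> w /= /le_trans; apply.
rewrite PX (_ : n%:R * (s * c) / s = c * n%:R); last by field; rewrite gt_eqF.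
apply: le_trans (chisq_lower_tail _ (chisq_total s0 mX PX n0)) _.
  by rewrite /c subr_gt0 e1 gerBl.
rewrite lee_fin ler_expR.
have := @ln1B_le R e; rewrite e0 e1 => /(_ isT); rewrite -/c => lnc.
have -> : - (n%:R * e ^+ 2 / 4) = n%:R / 2 * (- (e ^+ 2 / 2)) by field.
by apply: ler_wpM2l; [rewrite divr_ge0|rewrite {2}/c; lra].
Qed.

Lemma chisq_upper_dev (e M : R) : 0 <= e <= 1 / 3 -> s * (1 + e) <= M ->
  (P [set w | (M < X w)%R] <= (expR (- (3 * n%:R * e ^+ 2 / 16)))%:E)%E.
Proof.
move=> /andP[e0 e1] Ms; pose c := 1 + e.
apply: (@le_trans _ _ (P (~` [set w | X w <= s * c]))).
  apply: le_measure; rewrite ?inE.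
  - exact: measurable_superlevel.
  - exact/measurableC/measurable_sublevel.
  - by move=> w /= /(le_lt_trans Ms); rewrite ltNge => /negP.
rewrite probability_setC; last exact: measurable_sublevel.
rewrite PX (_ : n%:R * (s * c) / s = c * n%:R); last by field; rewrite gt_eqF.
apply: le_trans (chisq_upper_tail _ (chisq_total s0 mX PX n0)) _.
  by rewrite /c lerDl.
rewrite lee_fin ler_expR.
have := @ln1D_le R e; rewrite e0 e1 => /(_ isT); rewrite -/c => lnc.
have -> : - (3 * n%:R * e ^+ 2 / 16) = n%:R / 2 * (- (3 / 8 * e ^+ 2)) by field.
by apply: ler_wpM2l; [rewrite divr_ge0|rewrite {2}/c; lra].
Qed.

End deviations.

Lemma union_bound (R : realType) (d : measure_display) (T : measurableType d)
    (P : probability T R) (I : finType) (Q : {pred I}) (E : I -> set T) (u : R) :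
  (forall i, Q i -> measurable (E i)) -> (forall i, Q i -> P (E i) <= u%:E)%E ->
  measurable (\big[setU/set0]_(i | Q i) E i) /\
  (P (\big[setU/set0]_(i | Q i) E i) <= (#|Q|%:R * u)%:E)%E.
Proof.
move=> mE PE; have mU : measurable (\big[setU/set0]_(i | Q i) E i).
  exact: bigsetU_measurable.
split => //; rewrite mulrC mulr_natr -sumr_const -sumEFin.
suff [] : measurable (\big[setU/set0]_(i | Q i) E i) /\
    (P (\big[setU/set0]_(i | Q i) E i) <= \sum_(i in Q) u%:E)%E by [].
apply: (big_rec2 (fun A x => measurable A /\ (P A <= x)%E)).
  by rewrite measure0; split.
move=> i A x Qi [mA PA]; split; first by apply: measurableU => //; exact: mE.
by apply: le_trans (measureU2 _ _ _) _ => //; [exact: mE|apply: leeD => //; exact: PE].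
Qed.

Lemma measurable_card_gt (R : realType) (d : measure_display)
    (T : measurableType d) (p k : nat) (X : 'I_p -> T -> R) (l : 'I_p) :
  (forall j, measurable_fun setT (X j)) ->
  measurable [set w | (k <= #|[set j | (X l w < X j w)%R]%SET|)%N].
Proof.
move=> mX.
have mlt j : measurable [set w | X l w < X j w].
  have := measurable_fun_ltr (mX l) (mX j) measurableT (Y := [set true]) I.
  by rewrite setTI.
rewrite (_ : [set w | _] = \bigcup_(S in [set S : {set 'I_p} | (k <= #|S|)%N])
   \bigcap_(j in [set j | j \in S]) [set w | X l w < X j w]).
  apply: fin_bigcup_measurable => [|S _]; first exact: finite_finset.
  by apply: fin_bigcap_measurable.
apply/seteqP; split => w /=.
  move=> kw; exists [set j | X l w < X j w]%SET => //= j /=.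
  by rewrite inE.
move=> [S /= kS h]; apply: leq_trans kS _; apply: subset_leq_card.
by apply/fintype.subsetP => j jS; rewrite inE; exact: h.
Qed.

Lemma alpha_n_gt0 (R : realType) (gamma : R) (n : nat) :
  0 < gamma -> (1 < n)%N -> 0 < alpha_n gamma n.
Proof.
move=> g0 n1; rewrite /alpha_n !mulr_gt0 ?powR_gt0 ?sqrtr_gt0//.
  by rewrite ltr0n ltnW.
by rewrite ln_gt0// ltr1n.
Qed.

Lemma alpha_n_sqr (R : realType) (gamma : R) (n : nat) : (0 < n)%N ->
  n%:R * alpha_n gamma n ^+ 2 = gamma ^+ 2 * ln n%:R.
Proof.
move=> n0; have n0' : 0 < n%:R :> R by rewrite ltr0n.
rewrite /alpha_n !exprMn sqr_sqrtr; last by rewrite ln_ge0// ler1n.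
rewrite -(@powR_mulrn _ (n%:R `^ _) 2) ?powR_ge0// -powRrM.
rewrite (_ : - (1 / 2) * 2 = -1 :> R); last by field.
by rewrite powR_inv1 ?(ltW n0')//; field; rewrite gt_eqF.
Qed.

Lemma bexp_ln (R : realType) (gamma : R) (n : nat) : (0 < n)%N ->
  bexp gamma * ln n%:R =
  3 * (n%:R * (alpha_n gamma n / (4 + 2 * Num.sqrt 3)) ^+ 2).
Proof.
move=> n0; set q := 4 + _.
have s3 : Num.sqrt 3 ^+ 2 = 3 :> R by rewrite sqr_sqrtr.
have := alpha_n_sqr gamma n0; move: (alpha_n gamma n) => al hal.
by rewrite /bexp -/q !exprMn s3 [n%:R * _]mulrA hal; ring.
Qed.

Theorem theorem4 (R : realType) (d : measure_display) (T : measurableType d)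
  (P : probability T R) (p n k : nat) (sigma2 : 'I_p -> R)
  (shat2 : 'I_p -> T -> R) (gamma : R) :
  (1 <= n)%N ->
  (1 <= k <= p)%N ->
  (forall nu, 0 < sigma2 nu) ->
  0 < gamma ->
  (forall nu, measurable_fun setT (shat2 nu)) ->
  (* marginally, shat2 nu ~ sigma2 nu * chi^2_(n) / n *)
  (forall nu (x : R),
      P [set w | shat2 nu w <= x] = chisq_cdf n (n%:R * x / sigma2 nu)) ->
  let a := alpha_n gamma n in
  let sk := kth_largest sigma2 k in
  let I_in := [set l : 'I_p | sk * (1 + a) <= sigma2 l] in
  let I_out := [set l : 'I_p | sigma2 l <= sk * (1 - a)] in
  let FE := [set w | exists2 l, I_in l & shat2 l w < kth_largest (fun nu => shat2 nu w) k] in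
  let FI := [set w | exists2 l, I_out l & kth_largest (fun nu => shat2 nu w) k <= shat2 l w] in
  (P (FE `|` FI) <=
    ((2 * p%:R * k%:R) * (n%:R `^ (- bexp gamma))
     + k%:R * (n%:R `^ (- ((1 - 2 * a) * bexp gamma))))%:E)%E.
Proof.
move=> n0 kp s0 g0 mX PX.
pose a := alpha_n gamma n; pose sk := kth_largest sigma2 k.
pose I_in := [set l : 'I_p | sk * (1 + a) <= sigma2 l].
pose I_out := [set l : 'I_p | sigma2 l <= sk * (1 - a)].
pose FE := [set w | exists2 l, I_in l &
  shat2 l w < kth_largest (fun nu => shat2 nu w) k].
pose FI := [set w | exists2 l, I_out l &
  kth_largest (fun nu => shat2 nu w) k <= shat2 l w].
change (P (FE `|` FI) <= ((2 * p%:R * k%:R) * (n%:R `^ (- bexp gamma))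
  + k%:R * (n%:R `^ (- ((1 - 2 * a) * bexp gamma))))%:E)%E.
have /andP[k1 kp'] := kp.
have n1R : 1 <= n%:R :> R by rewrite ler1n.
have k1R : 1 <= k%:R :> R by rewrite ler1n.
have b0 : 0 <= bexp gamma by exact: sqr_ge0.
pose N l := [set w | (k <= #|[set j | (shat2 l w < shat2 j w)%R]%SET|)%N].
have mN l : measurable (N l) by exact: measurable_card_gt.
have ltkth l w : (shat2 l w < kth_largest (fun nu => shat2 nu w) k) =
    (k <= #|[set j | (shat2 l w < shat2 j w)%R]%SET|)%N.
  apply: (@kth_largest_up R p (fun nu => shat2 nu w) k (fun x => shat2 l w < x)) => //.
  by move=> x y xy /lt_le_trans; apply.
have mA : measurable (FE `|` FI).
  apply: measurableU.
    rewrite (_ : FE = \bigcup_(l in I_in) N l).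
      by apply: fin_bigcup_measurable => // l _; exact: mN.
    by apply/seteqP; split => w [l Il /= h]; exists l => //; move: h; rewrite /N/= ltkth.
  rewrite (_ : FI = \bigcup_(l in I_out) ~` N l).
    by apply: fin_bigcup_measurable => // l _; exact/measurableC/mN.
  by apply/seteqP; split => w [l Il /= h]; exists l => //; move: h;
    rewrite /N/= -ltkth leNgt => /negP.
have [n2|n2] := leqP n 1.
  have -> : n = 1%N by apply/eqP; rewrite eqn_leq n2.
  rewrite !powR1 !mulr1; apply: le_trans (probability_le1 _ mA) _.
  by rewrite lee_fin; apply: ler_wpDl; rewrite ?mulr_ge0.
have [a2|a2] := leP (1 / 2) a.
  apply: le_trans (probability_le1 _ mA) _.
  rewrite lee_fin; apply: ler_wpDl; first by rewrite ?mulr_ge0 ?powR_ge0.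
  apply: (@le_trans _ _ (1 * 1)); first by rewrite mulr1.
  apply: ler_pM => //.
  apply: (@le_trans _ _ (n%:R `^ 0)); first by rewrite powRr0.
  apply: ler_powR => //.
  by rewrite -mulNr mulr_ge0//; lra.
have a0 : 0 < a by exact: alpha_n_gt0.
have sk0 : 0 < sk.
  rewrite /sk (@kth_largest_up R p sigma2 k (fun x => 0 < x)) //.
    rewrite (_ : finset _ = [set: 'I_p]%SET) ?cardsT ?card_ord//.
    by apply/setP => j; rewrite !inE s0.
  by move=> x y xy /lt_le_trans; apply.
have topk : (#|[set j | (sk < sigma2 j)%R]%SET| < k)%N.
  rewrite ltnNge -(@kth_largest_up R p sigma2 k (fun x => sk < x)) ?ltxx//.
  by move=> x y xy /lt_le_trans; apply.
have topk' : (k <= #|[set j | (sk <= sigma2 j)%R]%SET|)%N.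
  rewrite -(@kth_largest_up R p sigma2 k (fun x => sk <= x)) ?lexx//.
  by move=> x y xy /le_trans; apply.
pose r := Num.sqrt 3 : R.
have r0 : 0 <= r by exact: sqrtr_ge0.
have r3 : r ^+ 2 = 3 by rewrite sqr_sqrtr.
pose q := 4 + 2 * r.
have q0 : 0 < q by rewrite /q; lra.
pose z := a / q.
have az : a = z * q by rewrite /z mulfVK// gt_eqF.
have z0 : 0 < z by rewrite divr_gt0.
have bz : bexp gamma * ln n%:R = 3 * (n%:R * z ^+ 2) by exact: bexp_ln.
pose e1 := 4 * z; pose e2 := 2 * r * z.
have e12 : e1 + e2 = a by rewrite az /e1 /e2 /q; ring.
have r1 : 1 <= r by rewrite -(@ler_sqr _ 1 r) ?nnegrE// r3; lra.
have e10 : 0 <= e1 by rewrite /e1; lra.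
have e20 : 0 <= e2 by rewrite /e2 mulr_ge0 ?(ltW z0)// mulr_ge0.
have e13 : e1 <= 1 / 3.
  have : 3 / 2 <= r by rewrite -(@ler_sqr _ (3 / 2) r) ?nnegrE// r3; lra.
  rewrite /e1 => r32; have : z * 7 <= z * q by rewrite ler_pM2l// /q; lra.
  by rewrite -az; lra.
pose M1 := sk * (1 + e1); pose M2 := sk * (1 - e2).
pose u := n%:R `^ (- bexp gamma); pose v := n%:R `^ (- ((1 - 2 * a) * bexp gamma)).
have n0R : n%:R != 0 :> R by rewrite gt_eqF// (lt_le_trans _ n1R).
have uE : u = expR (- (3 * (n%:R * z ^+ 2))).
  by rewrite /u /powR (negPf n0R) mulNr bz.
have vE : v = expR (- ((1 - 2 * a) * (3 * (n%:R * z ^+ 2)))).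
  by rewrite /v /powR (negPf n0R) mulNr -mulrA bz.
have up j M : sigma2 j * (1 + e1) <= M -> (P [set w | (M < shat2 j w)%R] <= u%:E)%E.
  move=> h; have := chisq_upper_dev n0 (s0 j) (mX j) (PX j) _ h.
  rewrite e10 e13 => /(_ isT) /le_trans; apply.
  by rewrite lee_fin uE ler_expR /e1; lra.
have lo j M : M <= sigma2 j * (1 - e2) -> (P [set w | (shat2 j w <= M)%R] <= u%:E)%E.
  move=> h; have := chisq_lower_dev n0 (s0 j) (mX j) (PX j) _ h.
  rewrite e20 (_ : e2 < 1); last by lra.
  move=> /(_ isT) /le_trans; apply.
  rewrite lee_fin uE ler_expR /e2 !exprMn r3; lra.
have lo' j : I_in j -> (P [set w | (shat2 j w <= M1)%R] <= v%:E)%E.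
  move=> Ij; pose e3 := e2 / (1 + a).
  have a1 : 0 < 1 + a by lra.
  have e3E : e3 * (1 + a) = e2 by rewrite /e3 mulfVK ?gt_eqF.
  have e30 : 0 <= e3 by rewrite divr_ge0 // ltW.
  have e31 : e3 < 1 by rewrite ltr_pdivrMr//; lra.
  have h : M1 <= sigma2 j * (1 - e3).
    apply: (@le_trans _ _ (sk * (1 + a) * (1 - e3))); last first.
      by apply: ler_wpM2r => //; lra.
    rewrite /M1 -mulrA ler_pM2l// mulrBr mulr1 [_ * e3]mulrC e3E; lra.
  have := chisq_lower_dev n0 (s0 j) (mX j) (PX j) _ h.
  rewrite e30 e31 => /(_ isT) /le_trans; apply.
  rewrite lee_fin vE ler_expR lerN2.
  have -> : n%:R * e3 ^+ 2 / 4 = (3 * (n%:R * z ^+ 2)) * (1 + a) ^- 2.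
    by rewrite /e3 /e2 !exprMn r3 exprVn; lra.
  rewrite mulrC; apply: ler_wpM2l; first by rewrite mulr_ge0// mulr_ge0// sqr_ge0.
  rewrite -[leRHS]mul1r ler_pdivlMr ?exprn_gt0//.
  nra.
pose E1 j := if sigma2 j <= sk then [set w | M1 < shat2 j w] else set0.
pose E2 j := if sk <= sigma2 j then [set w | shat2 j w <= M2] else
  if sigma2 j <= sk * (1 - a) then [set w | M2 < shat2 j w] else set0.
pose E3 j := [set w | shat2 j w <= M1].
have u0 : 0 <= u by exact: powR_ge0.
have v0 : 0 <= v by exact: powR_ge0.
have [mU1 PU1] : measurable (\big[setU/set0]_(j | predT j) E1 j) /\
    (P (\big[setU/set0]_(j | predT j) E1 j) <= (#|'I_p|%:R * u)%:E)%E.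
  apply: union_bound => j _; rewrite /E1; case: ifPn => // js.
    exact: measurable_superlevel.
  - by apply: up; rewrite /M1 ler_wpM2r//; lra.
  - by rewrite measure0 lee_fin.
have [mU2 PU2] : measurable (\big[setU/set0]_(j | predT j) E2 j) /\
    (P (\big[setU/set0]_(j | predT j) E2 j) <= (#|'I_p|%:R * u)%:E)%E.
  apply: union_bound => j _; rewrite /E2; case: ifPn => // js.
  - exact: measurable_sublevel.
  - by case: ifPn => // js'; exact: measurable_superlevel.
  - by apply: lo; rewrite /M2 ler_wpM2r//; lra.
  - case: ifPn => // js'; last by rewrite measure0 lee_fin.
    apply: up; rewrite /M2.
    apply: (@le_trans _ _ (sk * (1 - a) * (1 + e1))).
      by rewrite ler_wpM2r//; lra.
    rewrite -mulrA ler_pM2l// (_ : e2 = a - e1); last by lra.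
    nra.
pose Q3 := [pred j : 'I_p | sk * (1 + a) <= sigma2 j].
have [mU3 PU3] : measurable (\big[setU/set0]_(j | Q3 j) E3 j) /\
    (P (\big[setU/set0]_(j | Q3 j) E3 j) <= (#|Q3|%:R * v)%:E)%E.
  apply: union_bound => j Qj; first exact: measurable_sublevel.
  exact: lo'.
have Q3A j : Q3 j -> sk < sigma2 j.
  by move=> /= /(lt_le_trans _); apply; rewrite ltr_pMr//; lra.
have Q3k : (#|Q3| <= k)%N.
  apply: leq_trans (ltnW topk); apply: subset_leq_card.
  by apply/fintype.subsetP => j Qj; rewrite inE Q3A.
have sub : FE `|` FI `<=` \big[setU/set0]_(j | predT j) E1 j `|`
    (\big[setU/set0]_(j | predT j) E2 j `|` \big[setU/set0]_(j | Q3 j) E3 j).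
  have inU (Q : pred 'I_p) (E : 'I_p -> set T) j w : Q j -> E j w ->
      (\big[setU/set0]_(i | Q i) E i) w.
    by move=> Qj Ej; rewrite (bigD1 j)//=; left.
  move=> w [] [l /= Il].
    rewrite ltkth => kl.
    have [j] : exists j, (j \in [set j | shat2 l w < shat2 j w]%SET) &&
        (j \notin [set j | sk < sigma2 j]%SET).
      apply/existsP; apply: contraTT (leq_trans topk kl); rewrite -leqNgt => /existsPn h.
      apply: subset_leq_card; apply/fintype.subsetP => j jl.
      by have := h j; rewrite jl/= negbK.
    rewrite !inE -leNgt => /andP[lj jsk].
    have [M1l|lM1] := leP (shat2 l w) M1; first by right; right; exact: (inU _ _ l).
    left; apply: (inU _ _ j) => //; rewrite /E1 jsk /=.
    exact: lt_trans lj.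
  rewrite leNgt ltkth -ltnNge => kl.
  have [j] : exists j, (j \in [set j | sk <= sigma2 j]%SET) &&
      (j \notin [set j | shat2 l w < shat2 j w]%SET).
    apply/existsP; apply: contraTT (leq_trans kl topk'); rewrite -leqNgt => /existsPn h.
    apply: subset_leq_card; apply/fintype.subsetP => j jl.
    by have := h j; rewrite jl/= negbK.
  rewrite !inE -leNgt => /andP[jsk jl]; right; left.
  have [M2j|jM2] := leP (shat2 j w) M2.
    by apply: (inU _ _ j) => //; rewrite /E2 jsk.
  apply: (inU _ _ l) => //; rewrite /E2 Il ifF /=; first exact: lt_le_trans jl.
  apply/negbTE; rewrite -ltNge; apply: (le_lt_trans Il).
  by rewrite gtr_pMr//; lra.
apply: le_trans (le_measure _ _ _ sub) _; rewrite ?inE//.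
  by apply: measurableU => //; exact: measurableU.
apply: le_trans (measureU2 _ _ _) _ => //; first exact: measurableU.
apply: (@le_trans _ _ ((p%:R * u)%:E + ((p%:R * u)%:E + (k%:R * v)%:E))%E).
  apply: leeD; first by rewrite card_ord in PU1.
  apply: le_trans (measureU2 _ _ _) _ => //.
  apply: leeD; first by rewrite card_ord in PU2.
  by apply: (le_trans PU3); rewrite lee_fin ler_wpM2r// ler_nat.
rewrite -!EFinD lee_fin -/u -/v addrA lerD2r.
have -> : p%:R * u + p%:R * u = 2 * p%:R * u * 1 by ring.
by rewrite [leRHS]mulrAC; apply: ler_wpM2l => //; rewrite !mulr_ge0.
Qed.
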